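(* Let $T$ be an $n$-SLTM. Then there is a finite sequence of elementary triangular operations (ETO's) that transforms $T$ into a matrix $R$ that is in the first reduced echelon form ($1$-REF).
   Context: Let $\mathbb{F}$ be a field of characteristic different from $2$ and $\mathbb{F}^\times=\mathbb{F}\setminus\{0\}$. An $n$-SLTM is a strictly lower triangular $n\times n$ matrix with entries in $\mathbb{F}$; $0_n$ is the zero matrix. Intervals are intervals of integers; $[1,c[=\{1,\dots,c-1\}$. For an $n$-SLTM $T=[t_{ij}]$ and $r\in[1,n]$ let $c_r=\max\{j:t_{rj}\ne 0\}$ if the $r$-th row of $T$ is nonzero and $c_r=0$ otherwise. If $c_r>0$, $t_{r,c_r}$ is the leader of the $r$-th row and $(r,c_r)$ is its leader position. For $\alpha\in\mathbb{F}$ and $1\le i<j<k\le n$ put $\Delta^{(\alpha)}_{i,j,k}(T)=\alpha t_{ki}+t_{kj}t_{ji}$. First reduced echelon form ($1$-REF): an $n$-SLTM $S\ne 0_n$ is in $1$-REF if (1) all zero rows of $S$ are above all nonzero rows; (2) for each leader position $(r,c)$ we have $c>1$ and there is $i_0\in[1,c[$ with $\Delta^{(2)}_{i_0,c,r}(S)\neq 0$; (3) if $(r,c_r)$ and $(r+1,c_{r+1})$ are leader positions of rows $r$ and $r+1$, then $c_r\le c_{r+1}$. The zero matrix $0_n$ is also in $1$-REF. Elementary triangular operations (ETO's) are the following assignments $T\mapsto S=[s_{rk}]$ on $n$-SLTM, whenever defined. $\mathcal{P}$-operation: for $1\le r_1\le n$ and $\alpha\in\mathbb{F}^\times$, $S=\mathcal{P}_{r_1}(T,\alpha)$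 has $s_{rk}=\alpha^{-1}t_{rk}$ if $r=r_1$; $s_{rk}=\alpha t_{rk}$ if $k=r_1$; $s_{rk}=t_{rk}$ otherwise. $\mathcal{F}$-operation: for $1\le r_1<r_2\le n$, provided $t_{r_2j}=0$ for each $j\ge r_1$ and $t_{rr_1}=0$ for each $r_1\le r\le r_2$, $S=\mathcal{F}_{(r_1,r_2)}(T)$ has $s_{rk}=t_{r_2k}$ if $r=r_1$; $s_{rk}=t_{r_1k}$ if $r=r_2$; $s_{rk}=t_{rr_2}$ if $k=r_1$; $s_{rk}=t_{rr_1}$ if $k=r_2$; $s_{rk}=t_{rk}$ otherwise. $\mathcal{Q}$-operation: let $(r_0,k_0)$ be a position with $r_0>k_0$ and $t_{r_0,k}=0$ for all $k>k_0$, and $\beta\in\mathbb{F}^\times$. If either $k_0=1$, or $k_0>1$ and $\Delta^{(1)}_{i,k_0,r_0}(T)=\beta t_{k_0,i}$ for each $1\le i<k_0$, then $S=\mathcal{Q}_{(r_0,k_0)}(T,\beta)$ has $s_{rk}=t_{r_0,k_0}-2\beta$ if $(r,k)=(r_0,k_0)$; $s_{rk}=t_{r,k_0}+\beta t_{r,r_0}$ if $r>r_0$ and $k=k_0$; $s_{rk}=t_{rk}$ otherwise. *)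

(* Defs.v *)
From Stdlib Require Export Relation_Operators.
From mathcomp Require Export all_boot all_order all_algebra.

Set Implicit Arguments.
Unset Strict Implicit.
Unset Printing Implicit Defensive.

Import GRing.Theory.
Local Open Scope ring_scope.

(* Rows and columns are indexed by 'I_n, hence from 0: the integer interval
   [1, n] is shifted by one, and a condition such as "c > 1" on a column index
   reads (0 < c)%N here. *)

Definition sltm (F : fieldType) (n : nat) (T : 'M[F]_n) : Prop :=
  forall r k : 'I_n, (r <= k)%N -> T r k = 0.

(* The number c_r keeps its 1-based value, so that 0 denotes a zero row. *)
Definition lead_col (F : fieldType) (n : nat) (T : 'M[F]_n) (r : 'I_n) : nat :=
  \max_(j < n | T r j != 0) j.+1.

Definition leader_pos (F : fieldType) (n : nat) (T : 'M[F]_n) (r c : 'I_n)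
  : Prop :=
  lead_col T r = c.+1.

(* Meant for i < j < k. *)
Definition Delta (F : fieldType) (n : nat) (alpha : F) (i j k : 'I_n)
    (T : 'M[F]_n) : F :=
  alpha * T k i + T k j * T j i.

Definition zero_rows_above (F : fieldType) (n : nat) (S : 'M[F]_n) : Prop :=
  forall r s : 'I_n, row r S = 0 -> row s S != 0 -> (r < s)%N.

Definition leaders_nondegenerate (F : fieldType) (n : nat) (S : 'M[F]_n)
  : Prop :=
  forall r c : 'I_n, leader_pos S r c ->
    (0 < c)%N /\
    exists i0 : 'I_n, (i0 < c)%N /\ Delta 2%:R i0 c r S != 0.

Definition leaders_sorted (F : fieldType) (n : nat) (S : 'M[F]_n) : Prop :=
  forall r r' c c' : 'I_n, r' = r.+1 :> nat ->
    leader_pos S r c -> leader_pos S r' c' -> (c <= c')%N.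

Definition ref1 (F : fieldType) (n : nat) (S : 'M[F]_n) : Prop :=
  sltm S /\
  (S = 0 \/
   [/\ S != 0, zero_rows_above S, leaders_nondegenerate S
     & leaders_sorted S]).

Definition Pop (F : fieldType) (n : nat) (r1 : 'I_n) (T : 'M[F]_n) (alpha : F)
  : 'M[F]_n :=
  \matrix_(r, k)
    if r == r1 then alpha^-1 * T r k
    else if k == r1 then alpha * T r k
    else T r k.

(* Where several cases apply, they all give 0 under F_defined and sltm. *)
Definition Fop (F : fieldType) (n : nat) (r1 r2 : 'I_n) (T : 'M[F]_n)
  : 'M[F]_n :=
  \matrix_(r, k)
    if r == r1 then T r2 k
    else if r == r2 then T r1 k
    else if k == r1 then T r r2
    else if k == r2 then T r r1
    else T r k.

Definition F_defined (F : fieldType) (n : nat) (r1 r2 : 'I_n) (T : 'M[F]_n)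
  : Prop :=
  [/\ (r1 < r2)%N,
      forall j : 'I_n, (r1 <= j)%N -> T r2 j = 0
    & forall r : 'I_n, (r1 <= r <= r2)%N -> T r r1 = 0].

Definition Qop (F : fieldType) (n : nat) (r0 k0 : 'I_n) (T : 'M[F]_n)
    (beta : F) : 'M[F]_n :=
  \matrix_(r, k)
    if (r == r0) && (k == k0) then T r0 k0 - 2%:R * beta
    else if (r0 < r)%N && (k == k0) then T r k0 + beta * T r r0
    else T r k.

Definition Q_defined (F : fieldType) (n : nat) (r0 k0 : 'I_n) (T : 'M[F]_n)
    (beta : F) : Prop :=
  [/\ (k0 < r0)%N,
      forall k : 'I_n, (k0 < k)%N -> T r0 k = 0,
      beta != 0
    & k0 = 0%N :> nat \/
      (0 < k0)%N /\
      forall i : 'I_n, (i < k0)%N -> Delta 1 i k0 r0 T = beta * T k0 i].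

Inductive eto (F : fieldType) (n : nat) (T : 'M[F]_n) : 'M[F]_n -> Prop :=
| eto_P (r1 : 'I_n) (alpha : F) :
    sltm T -> alpha != 0 -> eto T (Pop r1 T alpha)
| eto_F (r1 r2 : 'I_n) :
    sltm T -> F_defined r1 r2 T -> eto T (Fop r1 r2 T)
| eto_Q (r0 k0 : 'I_n) (beta : F) :
    sltm T -> Q_defined r0 k0 T beta -> eto T (Qop r0 k0 T beta).

Definition eto_reachable (F : fieldType) (n : nat)
  : 'M[F]_n -> 'M[F]_n -> Prop :=
  clos_refl_trans 'M[F]_n (@eto F n).

(* Main.v *)
Require Import Defs.
From mathcomp Require Import all_boot all_order all_algebra.

(** Measure [T] by its vector [(c_1, ..., c_n)] of leader columns, ordered
lexicographically.  If [c_(r+1) < c_r], then [F_(r, r+1)] is defined, fixes the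
rows above [r] and lowers [c_r].  If the leader [(r, c)] is degenerate, then [Q]
with [beta = t_(r, c) / 2] is defined, fixes the rows above [r] and cancels the
leader.  If neither applies, then [T] is in 1-REF. *)

Set Implicit Arguments.
Unset Strict Implicit.
Unset Printing Implicit Defensive.

Import GRing.Theory.
Local Open Scope ring_scope.

Section LexicographicWeight.

Local Open Scope nat_scope.

Variable B : nat.

(** The number with base-[B] digits [c], most significant first. It turns the lexicographic order on
    vectors of digits into the order of [nat], so that ordinary induction gives termination. *)
Definition weight (n : nat) (c : 'I_n -> nat) : nat :=
  \sum_(j < n) c j * B ^ (n - j.+1).

Lemma weight_recl (n : nat) (c : 'I_n.+1 -> nat) :
  weight c = c ord0 * B ^ n + weight (fun j => c (lift ord0 j)).
Proof. by rewrite /weight big_ord_recl /= subn1. Qed.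

Lemma weight_bound (n : nat) (c : 'I_n -> nat) :
  (forall j, c j < B) -> weight c < B ^ n.
Proof.
elim: n c => [|n IHn] c cB; first by rewrite /weight big_ord0.
rewrite weight_recl expnS.
apply: (@leq_trans ((c ord0).+1 * B ^ n)); last by rewrite leq_mul2r cB orbT.
by rewrite mulSnr ltn_add2l; apply: IHn => j.
Qed.

(** Common leading digits cancel one by one. At the first difference, one unit of that digit
    outweighs all later digits of [c'] together, by [weight_bound]. *)
Lemma weight_lex (n : nat) (c c' : 'I_n -> nat) (i : 'I_n) :
    (forall j, c' j < B) -> (forall j : 'I_n, j < i -> c' j = c j) ->
  c' i < c i -> weight c' < weight c.
Proof.
elim: n c c' i => [|n IHn] c c' i; first by case: i.
move=> c'B eqc ltc; rewrite !weight_recl.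
case: (unliftP ord0 i) => [i'|] def_i; rewrite {}def_i in eqc ltc.
  rewrite eqc // ltn_add2l; apply: (IHn _ _ i') => // j ltji.
  by apply: eqc; rewrite /= /bump /= !add1n ltnS.
apply: (@leq_trans ((c' ord0).+1 * B ^ n)).
  by rewrite mulSnr ltn_add2l; apply: weight_bound => j.
by apply: leq_trans (leq_addr _ _); rewrite leq_mul2r ltc orbT.
Qed.

End LexicographicWeight.

Section EchelonReduction.

Variables (F : fieldType) (n : nat).
Implicit Types (T S : 'M[F]_n) (r s c i j k : 'I_n).

(** Leader columns count from 1 and indices from 0, so the bound [m] is itself the first index of
    the vanishing tail. *)
Lemma lead_col_leqP T r (m : nat) :
  reflect (forall j, (m <= j)%N -> T r j = 0) (lead_col T r <= m)%N.
Proof.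
apply: (iffP (bigmax_leqP _ _ _)) => [le_m j le_mj | T0 j].
  by apply/eqP; apply: contraLR le_mj => /le_m; rewrite -ltnNge.
by apply: contraR; rewrite -ltnNge ltnS => /T0->.
Qed.

Lemma lead_col_eq T S r r' :
  (forall k, T r k = S r' k) -> lead_col T r = lead_col S r'.
Proof. by move=> eqTS; apply: eq_bigl => k; rewrite eqTS. Qed.

Lemma lead_col_lt T r : (lead_col T r < n.+1)%N.
Proof. by apply/bigmax_leqP => j _. Qed.

Lemma sltm_lead_col T r : sltm T -> (lead_col T r <= r)%N.
Proof. by move=> slT; apply/lead_col_leqP => j /slT. Qed.

Lemma leader_pos_zero T r c k : leader_pos T r c -> (c < k)%N -> T r k = 0.
Proof. by move=> lead; move: k; apply/lead_col_leqP; rewrite lead. Qed.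

Lemma leader_pos_neq0 T r c : leader_pos T r c -> T r c != 0.
Proof.
move=> lead; apply/eqP => Trc0.
suff: (lead_col T r <= c)%N by rewrite lead ltnn.
apply/lead_col_leqP => j; rewrite leq_eqVlt => /orP[/eqP/val_inj<- //|].
exact: leader_pos_zero.
Qed.

Lemma lead_col_eq0 T r : (lead_col T r == 0)%N = (row r T == 0).
Proof.
rewrite -leqn0; apply/lead_col_leqP/eqP => [T0 | /rowP T0 j _].
  by apply/rowP => j; rewrite !mxE T0.
by have := T0 j; rewrite !mxE.
Qed.

Lemma lead_col_sorted T :
    (forall r r', r' = r.+1 :> nat -> (lead_col T r <= lead_col T r')%N) ->
  forall r s, (r <= s)%N -> (lead_col T r <= lead_col T s)%N.
Proof.
move=> sortT r [m]; elim: m => [|m IHm] lt_mn; rewrite leq_eqVlt.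
  by case/orP=> // /eqP eq_rm; rewrite (_ : r = Ordinal lt_mn) //; apply: val_inj.
case/orP=> [/eqP eq_rm|].
  by rewrite (_ : r = Ordinal lt_mn) //; apply: val_inj.
rewrite ltnS => le_rm; apply: leq_trans (IHm (ltnW lt_mn) le_rm) _.
exact: sortT.
Qed.

Definition lead_lex_lt S T : Prop :=
  exists i, (lead_col S i < lead_col T i)%N /\
    forall j, (j < i)%N -> lead_col S j = lead_col T j.

Lemma sort_step T r r' :
    sltm T -> r' = r.+1 :> nat -> (lead_col T r' < lead_col T r)%N ->
  exists S, [/\ eto T S, sltm S & lead_lex_lt S T].
Proof.
move=> slT def_r' ltT; have lt_rr' : (r < r')%N by rewrite def_r'.
have neq_r'r : (r' == r) = false by apply/negbTE; rewrite neq_ltn lt_rr' orbT.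
(* Strict triangularity gives [lead_col T r <= r], and row [r'] ends even earlier. Both conditions
   of [F_defined] on entries follow from this. *)
have r'0 : forall j, (r <= j)%N -> T r' j = 0.
  apply/lead_col_leqP; rewrite -ltnS.
  exact: leq_trans ltT (leq_trans (sltm_lead_col _ slT) _).
exists (Fop r r' T); split.
- apply: eto_F => //; split=> // s; rewrite def_r' leq_eqVlt.
  case/andP=> /orP[/eqP eq_rs _ | lt_rs le_sr]; first by rewrite slT ?eq_rs.
  rewrite (_ : s = r') ?r'0 //; apply: val_inj => /=.
  by apply/eqP; rewrite eqn_leq def_r' le_sr.
- move=> s k le_sk; rewrite !mxE.
  case: (eqVneq s r) => [eq_sr | _]; first by rewrite r'0 -?eq_sr.
  case: (eqVneq s r') => [eq_sr' | neq_sr'].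
    by rewrite slT // (leq_trans (ltnW lt_rr')) -?eq_sr'.
  case: (eqVneq k r) => [eq_kr | _].
    by rewrite slT // ltnW // (leq_ltn_trans _ lt_rr') -?eq_kr.
  case: (eqVneq k r') => [eq_kr' | _]; last exact: slT.
  (* The entry arriving in column [r'] is [T s r]. Since [s < r' = r.+1], it lies on or above the
     diagonal; adjacency of the two rows is used here. *)
  rewrite slT // -ltnS -def_r' ltn_neqAle -eq_kr' le_sk andbT eq_kr'.
  exact: neq_sr'.
- exists r; split=> [|j lt_jr].
    by rewrite (@lead_col_eq _ T r r') // => k; rewrite mxE eqxx.
  (* Above row [r], the exchanged columns [r] and [r'] contain only zeros. *)
  apply: lead_col_eq => k; rewrite mxE.
  have lt_jr' := ltn_trans lt_jr lt_rr'.
  rewrite -!val_eqE /= (ltn_eqF lt_jr) (ltn_eqF lt_jr') !val_eqE.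
  case: eqP => [-> | _]; first by rewrite !slT // ltnW.
  by case: eqP => [-> | //]; rewrite !slT // ltnW.
Qed.

Lemma cancel_step T r c :
    2%N \notin [pchar F] -> sltm T -> leader_pos T r c ->
    (forall i, (i < c)%N -> Delta 2%:R i c r T = 0) ->
  exists S, [/\ eto T S, sltm S & lead_lex_lt S T].
Proof.
move=> hF slT lead D0; have nz2 : 2%:R != 0 :> F by rewrite inE in hF.
have nzT := leader_pos_neq0 lead.
have lt_cr : (c < r)%N.
  by rewrite ltnNge; apply: contraNN nzT => /slT->.
exists (Qop r c T (T r c / 2%:R)); split.
- apply: eto_Q => //; split=> //.
  + by move=> k; apply: leader_pos_zero.
  + by rewrite mulf_neq0 ?invr_eq0.
  case: (posnP c) => [-> | c_gt0]; [by left | right; split=> // i lt_ic].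
  (* Doubled, the condition for [Qop] reads [2 T r i + 2 T r c * T c i = T r c * T c i], which is
     the vanishing of [Delta 2%:R i c r T]. *)
  apply: (mulfI nz2); rewrite [RHS]mulrA [2%:R * (_ / _)]mulrC divfK //.
  have:= D0 i lt_ic; rewrite /Delta mul1r mulrDr => /eqP.
  by rewrite addr_eq0 => /eqP->; rewrite [2%:R * (_ * _)]mulr_natl mulr2n addKr.
- move=> s k le_sk; rewrite mxE.
  case: ifP => [/andP[/eqP eq_sr /eqP eq_kc] | _].
    by move: le_sk; rewrite eq_sr eq_kc leqNgt lt_cr.
  case: ifP => [/andP[lt_rs /eqP eq_kc] | _]; last exact: slT.
  by move: le_sk; rewrite eq_kc leqNgt (ltn_trans lt_cr).
- exists r; split=> [|j lt_jr].
    rewrite lead ltnS; apply/lead_col_leqP => k.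
    rewrite leq_eqVlt mxE eqxx ltnn => /orP[/eqP/val_inj<- | lt_ck].
      by rewrite eqxx mulrC divfK // subrr.
    by rewrite -val_eqE /= gtn_eqF // (leader_pos_zero lead).
  apply: lead_col_eq => k; rewrite mxE -val_eqE /= (ltn_eqF lt_jr).
  by rewrite ltnNge (ltnW lt_jr).
Qed.

Lemma ref1_or_step T :
    2%N \notin [pchar F] -> sltm T ->
  ref1 T \/ exists S, [/\ eto T S, sltm S & lead_lex_lt S T].
Proof.
move=> hF slT.
case: (boolP [exists r : 'I_n, exists r' : 'I_n,
    (r' == r.+1 :> nat) && (lead_col T r' < lead_col T r)%N]).
  case/existsP=> r /existsP[r' /andP[/eqP def_r' ltT]].
  by right; apply: sort_step def_r' ltT.
move=> noF.
(* For [c = 0] the condition on [i] is vacuous, so a leader in the first column also counts as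
   degenerate. *)
case: (boolP [exists r : 'I_n, exists c : 'I_n, (lead_col T r == c.+1) &&
    [forall i : 'I_n, (i < c)%N ==> (Delta 2%:R i c r T == 0)]]).
  case/existsP=> r /existsP[c /andP[/eqP lead /forallP D0]].
  right; apply: cancel_step lead _ => // i lt_ic.
  by apply/eqP; apply: implyP lt_ic.
move=> noQ; left; split=> //.
have adjT r r' : r' = r.+1 :> nat -> (lead_col T r <= lead_col T r')%N.
  move=> def_r'; rewrite leqNgt; apply: contraNN noF => ltT.
  by apply/existsP; exists r; apply/existsP; exists r'; rewrite def_r' eqxx.
have sortT := lead_col_sorted adjT.
case: (eqVneq T 0) => [|nzT]; [by left | right; split=> //].
(* Zero rows have leader column 0, so monotonicity of the leader columns puts them on top. *)
- move=> r s /eqP; rewrite -!lead_col_eq0 => /eqP r0 nzs.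
  rewrite ltnNge; apply: contraNN nzs => /sortT.
  by rewrite r0 leqn0.
- move=> r c lead.
  have [i0 [lt_i0c nzD]] : exists i0 : 'I_n, (i0 < c)%N /\ Delta 2%:R i0 c r T != 0.
    move: noQ; rewrite negb_exists => /forallP/(_ r).
    rewrite negb_exists => /forallP/(_ c).
    rewrite lead eqxx negb_forall => /existsP[i0].
    by rewrite negb_imply => /andP[]; exists i0.
  by split; [apply: leq_ltn_trans lt_i0c | exists i0].
- by move=> r r' c c' /adjT; rewrite /leader_pos => leT lr lr'; rewrite lr lr' in leT.
Qed.

End EchelonReduction.

Theorem proposition3p4 (F : fieldType) (hF : 2%N \notin [pchar F])
  (n : nat) (T : 'M[F]_n) (hT : sltm T) :
  exists R : 'M[F]_n, eto_reachable T R /\ ref1 R.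
Proof.
(* Leader columns are at most [n], hence valid digits in base [n.+1]. *)
have [m] := ubnP (weight n.+1 (lead_col T)).
elim: m T hT => // m IHm T slT; rewrite ltnS => le_m.
have [refT | [S [TS slS [i [lt_i eq_i]]]]] := ref1_or_step hF slT.
  by exists T; split=> //; apply: rt_refl.
have [|R [SR refR]] := IHm S slS.
  exact: leq_trans (weight_lex (lead_col_lt S) eq_i lt_i) le_m.
by exists R; split=> //; apply: rt_trans SR; apply: rt_step.
Qed.
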